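(* Let $R$ be a ring and $M$ a left $R$-module. Then the following statements are equivalent: (1) $M$ is semi-compact; (2) every finitely solvable set of congruences $x\equiv x_{\alpha} \pmod{M[I_{\alpha}]}$ (where $\alpha\in\Lambda$, $\Lambda$ is an arbitrary index set, $x_{\alpha}\in M$ and $I_{\alpha}$ is a finitely generated left ideal of $R$ for each $\alpha\in\Lambda$) has a simultaneous solution in $M$; (3) every finitely solvable system of equations in one unknown $x$ of the form $r_jx=m_j$, $j\in J$ (with $J$ an arbitrary index set, $r_j\in R$, $m_j\in M$) is solvable in $M$; (4) for each left ideal $I$ of $R$, every homomorphism of left $R$-modules $h:I\rightarrow M$ for which the restriction to any finitely generated left subideal $I_0$ of $I$ can be extended to a homomorphism $R\rightarrow M$ extends itself to a homomorphism $R\rightarrow M$.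
   Context: Rings are associative with identity and modules are unitary. For a left ideal (or subset) $I$ of $R$, $M[I]=\{m\in M \mid Im=0\}$, a subgroup of $M$. A set of congruences or a system of equations is finitely solvable (in $M$) if each finite subset of it has a common solution in $M$. The left $R$-module $M$ is semi-compact if every finitely solvable set of congruences $x\equiv x_{\alpha}\pmod{M[I_{\alpha}]}$ ($\alpha\in\Lambda$, $x_\alpha\in M$, $I_\alpha$ a left ideal of $R$ for each $\alpha\in\Lambda$) has a simultaneous solution in $M$. Systems of equations $\sum_{i\in I} r_{ij}x_i=m_j$ ($j\in J$) are always assumed compatible: for any $s_j\in R$ ($j \in J$), only finitely many nonzero, if $\sum_{j}s_jr_{ij}=0$ for each $i$ then $\sum_j s_jm_j=0$. *)

(* Defs.v *)
From HB Require Import structures.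
From mathcomp Require Import all_boot all_order all_algebra.
From mathcomp Require Import boolp classical_sets cardinality fsbigop.

Set Implicit Arguments.
Unset Strict Implicit.
Unset Printing Implicit Defensive.

Import GRing.Theory.

Local Open Scope classical_set_scope.
Local Open Scope ring_scope.

(* [pzRingType] rather than [nzRingType]: the zero ring is allowed.
   Left ideals are the submodules of the regular left module [R^o]. Their
   membership predicate is boolean, which is no restriction here because
   [boolp] reflects every proposition into [bool]. *)
Notation left_ideal R := (submodClosed R^o).

Definition finitely_generated (R : pzRingType) (I : left_ideal R) : Prop :=
  exists (n : nat) (g : 'I_n -> R),
    forall r : R, r \in I <-> exists c : 'I_n -> R, r = \sum_(i < n) c i * g i.

Section IdealModule.
Variables (R : pzRingType) (I : left_ideal R).

Definition ideal_module : Type := {r : R^o | r \in I}.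

HB.instance Definition _ := [isSub of ideal_module for @sval R^o _].
HB.instance Definition _ := [Choice of ideal_module by <:].
HB.instance Definition _ := [SubChoice_isSubLmodule of ideal_module by <:].

End IdealModule.

Section Systems.
Variables (Lambda T : Type).

(* A system of conditions is given by the family of its solution sets. *)
Definition solvable (S : Lambda -> set T) : Prop :=
  exists x : T, forall a : Lambda, S a x.

Definition finitely_solvable (S : Lambda -> set T) : Prop :=
  forall A : set Lambda, finite_set A ->
    exists x : T, forall a : Lambda, A a -> S a x.

End Systems.

Section SemiCompact.
Variables (R : pzRingType) (M : lmodType R).

(* M[I] *)
Definition annihilated (I : left_ideal R) : set M :=
  [set m | forall r : R, r \in I -> r *: m = 0].

(* The solutions of x = x_a (mod M[I_a]). *)
Definition congruence_system (Lambda : Type) (xs : Lambda -> M)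
    (I : Lambda -> left_ideal R) (a : Lambda) : set M :=
  [set x | annihilated (I a) (x - xs a)].

Definition semi_compact : Prop :=
  forall (Lambda : Type) (xs : Lambda -> M) (I : Lambda -> left_ideal R),
    finitely_solvable (congruence_system xs I) ->
    solvable (congruence_system xs I).

Definition fg_semi_compact : Prop :=
  forall (Lambda : Type) (xs : Lambda -> M) (I : Lambda -> left_ideal R),
    (forall a : Lambda, finitely_generated (I a)) ->
    finitely_solvable (congruence_system xs I) ->
    solvable (congruence_system xs I).

(* The solutions of r_j x = m_j. *)
Definition equation_system (J : Type) (r : J -> R) (m : J -> M) (j : J) :
    set M :=
  [set x | r j *: x = m j].

(* [{classic J}] is [J] with the classical choice structure that sums with
   finite support require. *)
Definition compatible (J : Type) (r : J -> R) (m : J -> M) : Prop :=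
  forall s : {classic J} -> R, finite_set [set j | s j != 0] ->
    \sum_(j \in [set: {classic J}]) s j * r j = 0 ->
    \sum_(j \in [set: {classic J}]) s j *: m j = 0.

Definition one_unknown_solvable : Prop :=
  forall (J : Type) (r : J -> R) (m : J -> M),
    compatible r m ->
    finitely_solvable (equation_system r m) ->
    solvable (equation_system r m).

Definition extends_on (I0 I : left_ideal R) (h : {linear ideal_module I -> M})
    (f : {linear R^o -> M}) : Prop :=
  forall u : ideal_module I, val u \in I0 -> f (val u) = h u.

Definition fg_extension_property : Prop :=
  forall (I : left_ideal R) (h : {linear ideal_module I -> M}),
    (forall I0 : left_ideal R,
        finitely_generated I0 -> {subset I0 <= I} ->
        exists f : {linear R^o -> M}, extends_on I0 h f) ->
    exists f : {linear R^o -> M}, extends_on I h f.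

End SemiCompact.

(* Main.v *)
Require Import Defs.
From HB Require Import structures.
From mathcomp Require Import all_boot all_order all_algebra finmap.
From mathcomp Require Import boolp classical_sets cardinality fsbigop.

(** The four properties form a cycle of implications, and the only step in
which a homomorphism has to be built is the last one.

- Semi-compactness contains the case of finitely generated ideals.
- An equation [r x = m] that has a solution [y] is the congruence
  [x = y (mod M[R r])], because [M[R r]] is the kernel of multiplication by
  [r]; so systems of equations in one unknown are systems of congruences
  modulo principal ideals.
- A homomorphism [h : I -> M] extends to [R] iff some [x] satisfies
  [u x = h u] for all [u] in [I], the extension being [r |-> r x]
  ([linear_regularE], [eval_at]). Finite solvability of this system of
  equations is extendability of [h] from finitely generated ideals, and it
  entails compatibility ([finitely_solvable_compatible]).
- For the return to semi-compactness, consider any finitely solvable system on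
  [M]. It forces [r x = m] when finitely many of its conditions already imply
  this equation ([forces]). The scalars [r] whose value is forced are a left
  ideal ([forced_ideal]). Finite solvability makes [m] unique ([forces_uniq]),
  so that [r |-> m] is a homomorphism ([forced_value_linear]); finitely many
  forced equations have a common solution, so that it extends from finitely
  generated ideals. An extension to [R] is an [x] at which every forced
  equation holds ([fg_extension_realizes_forced]). A congruence
  [x = x_a (mod M[I_a])] is the conjunction of the equations
  [r x = r x_a] for [r] in [I_a], all of which it forces; hence this [x] solves
  every system of congruences. The forced ideal contains the sum of the [I_a]
  on which one would usually define [sum r_a |-> sum r_a x_a], and it spares
  the choice of a decomposition of each element of the sum. *)

Set Implicit Arguments.
Unset Strict Implicit.
Unset Printing Implicit Defensive.

Import GRing.Theory.

Local Open Scope classical_set_scope.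
Local Open Scope ring_scope.

Section SpanIdeal.
Variables (R : pzRingType) (n : nat) (g : 'I_n -> R).

Definition span_ideal : {pred R^o} :=
  fun r => `[< exists c : 'I_n -> R, r = \sum_(i < n) c i * g i >].

Lemma span_idealP (r : R) :
  r \in span_ideal <-> exists c : 'I_n -> R, r = \sum_(i < n) c i * g i.
Proof. by split=> /asboolP. Qed.

Lemma span_ideal_subsemimod_closed : GRing.subsemimod_closed span_ideal.
Proof.
split; first split.
- apply/span_idealP; exists (fun=> 0).
  by rewrite big1 // => i _; rewrite mul0r.
- move=> r s /span_idealP[c ->] /span_idealP[d ->]; apply/span_idealP.
  exists (fun i => c i + d i); rewrite -big_split.
  by apply: eq_bigr => i _; rewrite mulrDl.
- move=> a r /span_idealP[c ->]; apply/span_idealP.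
  exists (fun i => a * c i); rewrite [LHS]mulr_sumr.
  by apply: eq_bigr => i _; rewrite mulrA.
Qed.

HB.instance Definition _ :=
  GRing.isSubmodClosed.Build R R^o span_ideal span_ideal_subsemimod_closed.

Lemma span_ideal_fg : finitely_generated span_ideal.
Proof. by exists n, g => r; exact: span_idealP. Qed.

Lemma mem_span_ideal (i : 'I_n) : g i \in span_ideal.
Proof.
apply/span_idealP; exists (fun j => if j == i then 1 else 0).
rewrite (bigD1 i) //= eqxx mul1r big1 ?addr0 // => j /negPf->.
by rewrite mul0r.
Qed.

End SpanIdeal.

Section Evaluation.
Variables (R : pzRingType) (M : lmodType R).

(** Homomorphisms [R -> M] are the maps [r |-> r x]; this lemma and [eval_at]
    are the two directions of the identification with elements [x = f 1]. *)
Lemma linear_regularE (f : {linear R^o -> M}) (r : R) : f r = r *: f 1.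
Proof. by rewrite -linearZ /= /GRing.scale /= mulr1. Qed.

Definition eval_at (x : M) (r : R^o) : M := (r : R) *: x.

Lemma eval_at_linear (x : M) : linear (eval_at x).
Proof. by move=> a r s; rewrite /eval_at scalerDl -scalerA. Qed.

HB.instance Definition _ (x : M) :=
  GRing.isLinear.Build R R^o M _ (eval_at x) (eval_at_linear x).

End Evaluation.

Section Forced.
Variables (R : pzRingType) (M : lmodType R) (Lambda : Type).
Variable S : Lambda -> set M.

(** Quantifying over all solutions of a finite subsystem, rather than fixing a
    formula for [m], is what lets forced equations be added and scaled with no
    bookkeeping of indices. *)
Definition forces (r : R) (m : M) : Prop :=
  exists2 A : set Lambda, finite_set A &
    forall x, (forall a, A a -> S a x) -> r *: x = m.

Lemma forces_single (a : Lambda) (r : R) (m : M) :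
  (forall x, S a x -> r *: x = m) -> forces r m.
Proof.
move=> Sa; exists [set a]; first exact: finite_set1.
by move=> x Sx; apply: Sa; exact: Sx.
Qed.

Lemma forces0 : forces 0 0.
Proof. by exists set0 => // x _; rewrite scale0r. Qed.

Lemma forcesD (r r' : R) (m m' : M) :
  forces r m -> forces r' m' -> forces (r + r') (m + m').
Proof.
move=> [A finA Am] [A' finA' Am']; exists (A `|` A').
  by rewrite finite_setU.
move=> x AA'x; rewrite scalerDl Am ?Am' // => a aA; apply: AA'x; by [left|right].
Qed.

Lemma forcesZ (c r : R) (m : M) : forces r m -> forces (c * r) (c *: m).
Proof. by case=> A finA Am; exists A => // x Ax; rewrite -scalerA Am. Qed.

Definition forced_ideal : {pred R^o} := fun r => `[< exists m, forces r m >].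

Lemma forced_idealP (r : R) : r \in forced_ideal <-> exists m, forces r m.
Proof. by split=> /asboolP. Qed.

Lemma forced_ideal_subsemimod_closed : GRing.subsemimod_closed forced_ideal.
Proof.
split; first split.
- by apply/forced_idealP; exists 0; exact: forces0.
- move=> r s /forced_idealP[m rm] /forced_idealP[k sk]; apply/forced_idealP.
  by exists (m + k); exact: forcesD.
- move=> a r /forced_idealP[m rm]; apply/forced_idealP.
  by exists (a *: m); exact: forcesZ.
Qed.

HB.instance Definition _ :=
  GRing.isSubmodClosed.Build R R^o forced_ideal forced_ideal_subsemimod_closed.

(** The default 0 is never taken: see [forced_valueP]. *)
Definition forced_value (u : ideal_module forced_ideal) : M :=
  xget 0 [set m | forces (val u) m].

Lemma forced_valueP (u : ideal_module forced_ideal) :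
  forces (val u) (forced_value u).
Proof.
rewrite /forced_value; case: xgetP => [m _ // | none].
by have [m um] := (forced_idealP _).1 (valP u); case: (none m).
Qed.

Hypothesis finS : finitely_solvable S.

(** The two finite subsystems that force [m] and [m'] have a common solution
    [x], and both values are [r x]. *)
Lemma forces_uniq (r : R) (m m' : M) : forces r m -> forces r m' -> m = m'.
Proof.
move=> [A finA Am] [A' finA' Am'].
have [|x AA'x] := finS (A := A `|` A'); first by rewrite finite_setU.
rewrite -(Am x) ?(Am' x) // => a aA; apply: AA'x; by [left|right].
Qed.

Lemma forced_value_linear : linear forced_value.
Proof.
move=> a u v; apply: forces_uniq (forced_valueP _) _.
rewrite linearP; apply: forcesD (forced_valueP v).
exact: forcesZ (forced_valueP u).
Qed.

Lemma forces_finitely_realized (n : nat) (g : 'I_n -> R) (m : 'I_n -> M) :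
  (forall i, forces (g i) (m i)) -> exists x, forall i, g i *: x = m i.
Proof.
move=> gm.
have {}gm i : exists A, finite_set A /\
    forall x, (forall a, A a -> S a x) -> g i *: x = m i.
  by have [A] := gm i; exists A.
have [A /all_and2[finA Am]] := choice gm.
have [|x Ax] := finS (A := \bigcup_(i in [set: 'I_n]) A i).
  exact: bigcup_finite.
by exists x => i; apply: Am => a Aa; apply: Ax; exists i.
Qed.

(** The extension property is applied to [r |-> forced value of r]. On the ideal
    spanned by [g_1, ..., g_n] this map is [r |-> r x], for an [x] that realizes
    the forced equations of the [g_i]; [x] need not satisfy the system itself
    beyond the finite part that forces these equations. *)
Lemma fg_extension_realizes_forced :
  fg_extension_property M -> exists x, forall r m, forces r m -> r *: x = m.
Proof.
move=> extM.
pose hl := GRing.isLinear.Build R (ideal_module forced_ideal) M _ forced_value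
  forced_value_linear.
pose h : {linear ideal_module forced_ideal -> M} :=
  HB.pack forced_value hl.
have [I0 [n [g I0g]] I0sub|f fh] := extM _ h.
  have gI0 i : g i \in I0.
    by apply/I0g; apply/(span_idealP g)/mem_span_ideal.
  have gF i : g i \in forced_ideal by apply/I0sub/gI0.
  pose m i := forced_value (exist _ (g i) (gF i)).
  have [|x gx] := @forces_finitely_realized n g m.
    by move=> i; exact: (forced_valueP (exist _ (g i) (gF i))).
  exists (eval_at x) => u /I0g[c uE].
  have uM : forces (val u) (val u *: x).
    rewrite {}uE scaler_suml.
    elim/big_ind2 : _ => [|r k r' k' rk rk'|i _].
    - exact: forces0.
    - exact: forcesD.
    - rewrite -scalerA gx; apply: forcesZ.
      exact: (forced_valueP (exist _ (g i) (gF i))).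
  exact: forces_uniq uM (forced_valueP u).
exists (f 1) => r m rm.
have rF : r \in forced_ideal by apply/forced_idealP; exists m.
rewrite -linear_regularE (fh (exist _ r rF) rF).
exact: forces_uniq (forced_valueP (exist _ r rF)) rm.
Qed.

End Forced.

Section Equivalences.
Variables (R : pzRingType) (M : lmodType R).

(** Only finitely many equations enter a relation [sum s_j r_j = 0]; at a common
    solution [x] of those, [sum s_j m_j] is [(sum s_j r_j) x]. *)
Lemma finitely_solvable_compatible (J : Type) (r : J -> R) (m : J -> M) :
  finitely_solvable (equation_system r m) -> compatible r m.
Proof.
move=> fsol s fins sr0; have [x xE] := fsol _ fins.
pose D : {fset {classic J}} := fset_set [set j | s j != 0].
have sD j : j \notin D -> s j = 0.
  by rewrite in_fset_set // notin_setE => /negP; rewrite negbK => /eqP.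
rewrite (fsbigTE D) => [|j /sD->]; last by rewrite scale0r.
rewrite (fsbigTE D) in sr0; last by move=> j /sD->; rewrite mul0r.
transitivity ((\sum_(j <- D) s j * r j) *: x); last by rewrite sr0 scale0r.
rewrite scaler_suml; apply: eq_big_seq => j.
by rewrite in_fset_set // inE /= => sj; rewrite -scalerA xE.
Qed.

Lemma annihilated_principal (r : R) (x : M) :
  annihilated (span_ideal (fun _ : 'I_1 => r)) x <-> r *: x = 0.
Proof.
split=> [ann|rx _ /span_idealP[c ->]].
  exact/ann/(mem_span_ideal (fun _ : 'I_1 => r) ord0).
by rewrite big_ord1 -scalerA rx scaler0.
Qed.

Lemma fg_semi_compact_one_unknown :
  fg_semi_compact M -> one_unknown_solvable M.
Proof.
move=> fgM J r m _ fsol.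
have sol1 j : exists x, r j *: x = m j.
  by have [x xE] := fsol [set j] (finite_set1 j); exists x; apply: xE.
have {sol1}[y yE] := choice sol1.
pose I j : left_ideal R := span_ideal (fun _ : 'I_1 => r j).
have congE j x : congruence_system y I j x <-> equation_system r m j x.
  rewrite /congruence_system /equation_system /= annihilated_principal.
  by rewrite scalerBr yE; split=> [/subr0_eq|->]; rewrite ?subrr.
have [||x xE] := fgM J y I.
- by move=> j; exact: span_ideal_fg.
- move=> A finA; have [x xE] := fsol A finA.
  by exists x => j /xE/congE.
- by exists x => j; apply/congE.
Qed.

Lemma one_unknown_fg_extension :
  one_unknown_solvable M -> fg_extension_property M.
Proof.
move=> solM I h ext.
pose r (u : ideal_module I) : R := val u.
have fsol : finitely_solvable (equation_system r h).
  move=> A /finite_seqP[s ->].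
  pose g (i : 'I_(size s)) : R := val (tnth (in_tuple s) i).
  have gI : {subset span_ideal g <= I}.
    move=> _ /span_idealP[c ->]; apply: rpred_sum => i _.
    exact: (GRing.rpredZ (c i) _ (svalP (tnth (in_tuple s) i))).
  have [f fh] := ext _ (span_ideal_fg g) gI.
  exists (f 1) => u /= us; rewrite /equation_system /= -linear_regularE.
  apply: fh; have /tnthP[i ->] : u \in in_tuple s by [].
  exact: (mem_span_ideal g i).
have [x xE] := solM _ r h (finitely_solvable_compatible fsol) fsol.
by exists (eval_at x) => u _; exact: xE.
Qed.

Lemma fg_extension_semi_compact : fg_extension_property M -> semi_compact M.
Proof.
move=> extM Lambda xs I fsol.
have [x xE] := fg_extension_realizes_forced fsol extM.
exists x => a r rI; rewrite scalerBr; apply/eqP; rewrite subr_eq0; apply/eqP.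
apply: xE; apply: (@forces_single _ _ _ _ a) => y /(_ r rI).
by rewrite scalerBr => /subr0_eq.
Qed.

End Equivalences.

Theorem proposition1p2 (R : pzRingType) (M : lmodType R) :
  [<-> semi_compact M;
       fg_semi_compact M;
       one_unknown_solvable M;
       fg_extension_property M].
Proof.
tfae.
- by move=> scM Lambda xs I _; exact: scM.
- exact: fg_semi_compact_one_unknown.
- exact: one_unknown_fg_extension.
- exact: fg_extension_semi_compact.
Qed.
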